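(* Assume that $Z$ has a finite second moment and satisfies the linearity condition $Q_c\,\mathbb{E}[Z|P_cZ]=0$ a.s. and the diagonal conditional variance condition: there is a real random variable $\lambda^{\ast}_{\omega}$ such that $\operatorname{var}(Z|P_cZ)=\lambda^{\ast}_{\omega}Q_c$ a.s. Then, for every measurable function $\psi:\mathbb{R}\to\mathbb{R}$ such that $ZZ^T\psi(Y)$ is integrable, setting $M_\psi=\mathbb{E}[ZZ^T\psi(Y)]$, we have $$\operatorname{span}(M_{\psi}-\lambda_{\psi}^{\ast}I)\subset E_c,\qquad\text{where}\quad \lambda_{\psi}^{\ast}=\frac{1}{p-d}\,\mathbb{E}\left[\|Q_cZ\|^2\psi(Y)\right].$$
   Context: $Y$ is a real random variable, $X$ a random vector in $\mathbb{R}^p$ with invertible covariance matrix $\Sigma$, and $Z=\Sigma^{-1/2}(X-\mathbb{E}[X])$, so $\mathbb{E}[Z]=0$ and $\operatorname{var}(Z)=I$. A dimension reduction subspace (DRS) for $Z$ is a linear subspace $E\subset\mathbb{R}^p$ such that $Y$ and $Z$ are conditionally independent given $PZ$, $P$ being the orthogonal projection on $E$. The (standardized) central subspace $E_c$ is the unique DRS of minimal dimension, equal to the intersection of all DRS. Standing assumption: $X$ has a density whose support has a boundary of Lebesgue measure $0$, and $E_c$ exists. $P_c$ is the orthogonal projection on $E_c$, $Q_c=I-P_c$, $d=\dim E_c<p$. $\operatorname{span}(M)$ is the column space of the matrix $M$. $\operatorname{var}(Z|P_cZ)$ is the conditional covariance matrix. *)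

(* Defs.v *)
From HB Require Import structures.
From mathcomp Require Import all_boot all_order all_algebra.
From mathcomp Require Import all_classical all_reals all_analysis.

Set Implicit Arguments.
Unset Strict Implicit.
Unset Printing Implicit Defensive.

Import Order.TTheory GRing.Theory Num.Theory.
Import numFieldNormedType.Exports.
Local Open Scope classical_set_scope.
Local Open Scope ring_scope.

(* Matrices carry the product sigma-algebra of their entries, i.e. the Borel
   sigma-algebra of R^(m * n) when T is the real line. *)
Definition mx_display : measure_display -> measure_display.
Proof. exact. Qed.

Definition mx_coords {d} {T : measurableType d} {m n : nat} :
    set (set 'M[T]_(m, n)) :=
  \bigcup_(ij in [set: 'I_m * 'I_n])
    preimage_set_system setT (fun M : 'M[T]_(m, n) => M ij.1 ij.2) measurable.

Section measurable_matrix.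
Context {d} {T : measurableType d}.
Variables m n : nat.

Let mx_set0 : <<s @mx_coords d T m n >> set0.
Proof. exact: sigma_algebra0. Qed.

Let mx_setC A : <<s @mx_coords d T m n >> A -> <<s mx_coords >> (~` A).
Proof. exact: sigma_algebraC. Qed.

Let mx_bigcup (F : _^nat) : (forall i, <<s @mx_coords d T m n >> (F i)) ->
  <<s mx_coords >> (\bigcup_i (F i)).
Proof. exact: sigma_algebra_bigcup. Qed.

HB.instance Definition _ := @isMeasurable.Build (mx_display d)
  'M[T]_(m, n) <<s mx_coords >> mx_set0 mx_setC mx_bigcup.

End measurable_matrix.

Lemma measurable_coord d (T : measurableType d) m n (i : 'I_m) (j : 'I_n) :
  measurable_fun setT (fun M : 'M[T]_(m, n) => M i j).
Proof.
move=> _ B mB; rewrite setTI; apply: sub_sigma_algebra.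
by exists (i, j) => //; exists B => //; rewrite setTI.
Qed.

Lemma measurable_fun_mxP d d' (S : measurableType d) (T : measurableType d')
    m n (f : S -> 'M[T]_(m, n)) :
  measurable_fun setT f <-> forall i j, measurable_fun setT (fun x => f x i j).
Proof.
split=> [mf i j|mf].
  exact: (measurableT_comp (@measurable_coord _ _ _ _ i j) mf).
apply: (@measurability _ _ _ _ setT f mx_coords) => //.
move=> _ [_ [[i j] _ [B mB <-]] <-].
by rewrite setTI; have := mf i j measurableT B mB; rewrite !setTI.
Qed.

Section lebesgue_cV.
Context (R : realType).
Local Open Scope ereal_scope.

Definition cV_cons n (xv : R * 'cV[R]_n) : 'cV[R]_n.+1 :=
  (col_mx xv.1%:M xv.2 : 'cV[R]_(1 + n)).

Definition cV_uncons n (v : 'cV[R]_n.+1) : R * 'cV[R]_n :=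
  (v ord0 ord0, (dsubmx (v : 'cV[R]_(1 + n)))).

Lemma cV_consK n : cancel (@cV_cons n) (@cV_uncons n).
Proof.
move=> [x v]; rewrite /cV_cons /cV_uncons /=; congr pair; last first.
  by rewrite col_mxKd.
by rewrite mxE; case: splitP => // k _; rewrite mxE ord1 eqxx.
Qed.

Lemma cV_unconsK n : cancel (@cV_uncons n) (@cV_cons n).
Proof.
move=> v; rewrite /cV_cons /cV_uncons /=.
rewrite (_ : (v ord0 ord0)%:M = usubmx (v : 'cV[R]_(1 + n))).
  exact: (@vsubmxK R 1 n 1 v).
apply/matrixP => i j; rewrite !mxE !ord1 eqxx mulr1n.
by congr (v _ _); exact/val_inj.
Qed.

Lemma measurable_cV_cons n : measurable_fun setT (@cV_cons n).
Proof.
apply/measurable_fun_mxP => i j.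
rewrite /cV_cons; case: (splitP (i : 'I_(1 + n))) => k ik.
  rewrite (_ : (fun x => _) = fst); first exact: measurable_fst.
  apply/funext => -[x v] /=; rewrite mxE; case: splitP => l il.
    by rewrite mxE !ord1 eqxx.
  by move: il; rewrite ik ord1.
rewrite (_ : (fun x => _) = (fun v : 'cV[R]_n => v k j) \o snd).
  apply: measurableT_comp; last exact: measurable_snd.
  exact: measurable_coord.
apply/funext => -[x v] /=; rewrite mxE; case: splitP => l il.
  by move: il; rewrite ik ord1.
by congr (v _ _); apply/val_inj/eqP; rewrite -(eqn_add2l 1) -il -ik.
Qed.

Lemma measurable_cV_uncons n : measurable_fun setT (@cV_uncons n).
Proof.
apply/measurable_fun_pairP; split; first exact: measurable_coord.
apply/measurable_fun_mxP => i j.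
rewrite (_ : (fun x => _) = (fun v : 'cV[R]_n.+1 => v (rshift 1 i) j)).
  exact: measurable_coord.
by apply/funext => v; rewrite /= mxE.
Qed.

Section step.
Variable n : nat.
Variable m : {sigma_finite_measure set 'cV[R]_n -> \bar R}.

Local Notation mu := (@lebesgue_measure R).

Definition lebesgue_cV_step : set 'cV[R]_n.+1 -> \bar R :=
  pushforward (mu \x m) (@cV_cons n).

Let step_preimage A : measurable A -> measurable (@cV_cons n @^-1` A).
Proof.
by move=> mA; rewrite -[X in measurable X]setTI; exact: measurable_cV_cons.
Qed.

Let step0 : lebesgue_cV_step set0 = 0.
Proof. by rewrite /lebesgue_cV_step /pushforward preimage_set0 measure0. Qed.

Let step_ge0 A : 0 <= lebesgue_cV_step A.
Proof. by rewrite /lebesgue_cV_step /pushforward measure_ge0. Qed.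

Let step_sigma_additive : semi_sigma_additive lebesgue_cV_step.
Proof.
move=> F mF tF mUF; rewrite /lebesgue_cV_step /pushforward preimage_bigcup.
apply: measure_semi_sigma_additive.
- by move=> k; exact: step_preimage.
- apply/trivIsetP => /= i j _ _ ij; rewrite -preimage_setI.
  by move/trivIsetP : tF => /(_ _ _ _ _ ij) ->//; rewrite preimage_set0.
- by rewrite -preimage_bigcup; exact: step_preimage.
Qed.

HB.instance Definition _ := isMeasure.Build _ _ _ lebesgue_cV_step
  step0 step_ge0 step_sigma_additive.

Let sfin : sigma_finite setT lebesgue_cV_step.
Proof.
have /sigma_finiteP[F [FT ndF Foo]] := sigma_finiteT mu.
have /sigma_finiteP[G [GT ndG Goo]] := sigma_finiteT m.
exists (fun k => @cV_uncons n @^-1` (F k `*` G k)).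
  rewrite -preimage_bigcup (_ : \bigcup_i _ = setT) ?preimage_setT//.
  apply/seteqP; split=> // -[x y] _.
  have [i _ Fx] : (\bigcup_i F i) x by rewrite -FT.
  have [j _ Gy] : (\bigcup_i G i) y by rewrite -GT.
  exists (maxn i j) => //; split.
    by move: x Fx; exact/subsetPset/ndF/leq_maxl.
  by move: y Gy; exact/subsetPset/ndG/leq_maxr.
move=> k; have [mF Fk] := Foo k; have [mG Gk] := Goo k.
have mFG : measurable (F k `*` G k) by exact: measurableX.
split; first by rewrite -[X in measurable X]setTI; exact: measurable_cV_uncons.
rewrite /lebesgue_cV_step /pushforward.
rewrite (_ : _ @^-1` _ = F k `*` G k); last first.
  by apply/seteqP; split=> x; rewrite /preimage /mkset cV_consK.
by rewrite product_measure1E// lte_mul_pinfty// ge0_fin_numE.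
Qed.

HB.instance Definition _ := Measure_isSigmaFinite.Build _ _ _
  lebesgue_cV_step sfin.

End step.

(* Lebesgue measure on R^n: the image of the product of Lebesgue measure on R
   and Lebesgue measure on R^(n-1). *)
Fixpoint lebesgue_cV n : {sigma_finite_measure set 'cV[R]_n -> \bar R} :=
  match n with
  | 0 => \d_(0%R : 'cV[R]_0)
  | n'.+1 => lebesgue_cV_step (lebesgue_cV n')
  end.

Lemma lebesgue_cV_box n (a b : 'I_n -> R) : (forall i, (a i <= b i)%R) ->
  lebesgue_cV n [set v | forall i, (a i <= v i ord0 <= b i)%R] =
  (\prod_(i < n) (b i - a i))%:E.
Proof.
elim: n a b => [|n IH] a b ab.
  rewrite big_ord0 /= diracE mem_set//= => -[]//.
pose B := [set v : 'cV[R]_n |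
  forall i, (a (lift ord0 i) <= v i ord0 <= b (lift ord0 i))%R].
rewrite /= /lebesgue_cV_step /pushforward.
rewrite (_ : _ @^-1` _ = `[a ord0, b ord0]%classic `*` B); last first.
  apply/seteqP; split=> -[x v] /=.
    move=> H; split.
      have := H ord0; rewrite in_itv /cV_cons mxE.
      by case: splitP => // k _; rewrite mxE ord1 eqxx.
    move=> i; have := H (lift ord0 i); rewrite /cV_cons mxE.
    case: splitP => k ik; first by move: ik; rewrite ord1.
    by have -> : i = k by apply/val_inj/eqP; rewrite -(eqn_add2l 1) -ik.
  move=> [xab Bv] i; rewrite /cV_cons mxE; case: splitP => k ik.
    rewrite mxE ord1 eqxx; move: xab; rewrite in_itv /=.
    by have -> : i = ord0 by apply/val_inj; rewrite /= ik ord1.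
  have -> : i = lift ord0 k by exact/val_inj.
  exact: Bv.
rewrite product_measure1E//; last first.
  rewrite (_ : B = \bigcap_(i in [set: 'I_n]) ((fun v : 'cV[R]_n => v i ord0)
      @^-1` `[a (lift ord0 i), b (lift ord0 i)]%classic)); last first.
    by apply/seteqP; split=> v Bv i => [_|]; have := Bv i; rewrite /= in_itv;
      [exact|exact].
  apply: fin_bigcap_measurable => // i _; rewrite -[X in measurable X]setTI.
  exact: measurable_coord.
rewrite IH; last by move=> i; exact: ab.
rewrite [X in X * _](_ : _ = (b ord0 - a ord0)%:E).
  by rewrite -EFinM big_ord_recl.
rewrite [LHS](lebesgue_measure_itv `[a ord0, b ord0])/= lte_fin.
rewrite lt_neqAle ab andbT.
by case: (eqVneq (a ord0) (b ord0)) => [->|_] /=; rewrite ?subrr ?EFinB.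
Qed.

End lebesgue_cV.

Section linear_algebra.
Context (R : realType).

Definition sqnorm p (v : 'cV[R]_p) : R := \sum_i v i 0 ^+ 2.

Definition colspan m n (M : 'M[R]_(m, n)) : {vspace 'cV[R]_m} :=
  <<[seq col j M | j <- enum 'I_n]>>%VS.

(* Columns: the basis of E chosen by the library. *)
Definition basis_mx p (E : {vspace 'cV[R]_p}) : 'M[R]_(p, \dim E) :=
  \matrix_(i, j) (vbasis E)`_j i 0.

Definition orthoproj p (E : {vspace 'cV[R]_p}) : 'M[R]_p :=
  let B := basis_mx E in B *m invmx (B^T *m B) *m B^T.

Lemma sqnormE p (v : 'cV[R]_p) : (v^T *m v) 0 0 = sqnorm v.
Proof. by rewrite mxE; apply: eq_bigr => i _; rewrite mxE expr2. Qed.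

Lemma sqnorm_eq0 p (v : 'cV[R]_p) : (sqnorm v == 0) = (v == 0).
Proof.
apply/eqP/eqP => [v0|->]; last first.
  by rewrite /sqnorm big1// => i _; rewrite mxE expr0n.
apply/colP => i; rewrite mxE; apply/eqP; rewrite -sqrf_eq0; apply/eqP.
by apply: (psumr_eq0P _ v0) => // j _; exact: sqr_ge0.
Qed.

Lemma basis_mx_mul p (E : {vspace 'cV[R]_p}) (x : 'cV[R]_(\dim E)) :
  basis_mx E *m x = \sum_(j < \dim E) x j 0 *: (vbasis E)`_j.
Proof.
apply/colP => i; rewrite summxE mxE; apply: eq_bigr => j _.
by rewrite !mxE mulrC.
Qed.

Lemma basis_mx_in p (E : {vspace 'cV[R]_p}) (x : 'cV[R]_(\dim E)) :
  basis_mx E *m x \in E.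
Proof.
rewrite basis_mx_mul; apply: memv_suml => j _; apply: memvZ.
by apply: vbasis_mem; rewrite mem_nth// size_tuple.
Qed.

Lemma basis_mx_onto p (E : {vspace 'cV[R]_p}) (u : 'cV[R]_p) : u \in E ->
  exists x, u = basis_mx E *m x.
Proof.
move=> uE; exists (\col_j coord (vbasis E) j u).
rewrite basis_mx_mul [LHS](coord_vbasis uE).
by apply: eq_bigr => j _; rewrite mxE.
Qed.

Lemma basis_mx_inj p (E : {vspace 'cV[R]_p}) (x : 'cV[R]_(\dim E)) :
  basis_mx E *m x = 0 -> x = 0.
Proof.
rewrite basis_mx_mul => Bx0; apply/colP => j; rewrite [RHS]mxE.
have /freeP Bfree : free (vbasis E) by exact: basis_free (vbasisP E).
exact: (Bfree (fun j => x j 0) Bx0 j).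
Qed.

Lemma basis_mx_gram_unit p (E : {vspace 'cV[R]_p}) :
  (basis_mx E)^T *m basis_mx E \in unitmx.
Proof.
rewrite -unitmx_tr trmx_mul trmxK -row_free_unit -kermx_eq0.
apply/eqP/row_matrixP => i; rewrite row0; set x := row i _.
have xG : x *m ((basis_mx E)^T *m basis_mx E) = 0.
  by apply/eqP; rewrite -sub_kermx row_sub.
apply: trmx_inj; rewrite trmx0; apply: basis_mx_inj; apply/eqP.
rewrite -sqnorm_eq0 -sqnormE trmx_mul trmxK mulmxA -(mulmxA x) xG mul0mx.
by rewrite mxE.
Qed.

(* orthoproj E is the orthogonal projection on E: its values lie in E, and the
   residuals are orthogonal to E. *)
Lemma orthoproj_in p (E : {vspace 'cV[R]_p}) (v : 'cV[R]_p) :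
  orthoproj E *m v \in E.
Proof. by rewrite /orthoproj -!mulmxA basis_mx_in. Qed.

Lemma orthoproj_orth p (E : {vspace 'cV[R]_p}) (u v : 'cV[R]_p) :
  u \in E -> u^T *m (v - orthoproj E *m v) = 0.
Proof.
move=> /basis_mx_onto[x ->].
rewrite /orthoproj trmx_mul -mulmxA mulmxBr -!mulmxA.
by rewrite (mulmxA _ (basis_mx E)) mulKVmx ?basis_mx_gram_unit// subrr.
Qed.

(* S = A^{-1/2}: the symmetric positive definite square root of A^{-1} *)
Definition is_invsqrtmx p (A S : 'M[R]_p) : Prop :=
  [/\ S^T = S, (forall v : 'cV[R]_p, v != 0 -> 0 < (v^T *m S *m v) 0 0) &
      S *m S = invmx A].

End linear_algebra.

Section moments.
Context d (T : measurableType d) (R : realType) (P : probability T R).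

Definition mx_expectation m n (W : T -> 'M[R]_(m, n)) : 'M[R]_(m, n) :=
  \matrix_(i, j) fine 'E_P[fun w => W w i j].

Definition mx_integrable m n (W : T -> 'M[R]_(m, n)) : Prop :=
  forall i j, P.-integrable setT (fun w => (W w i j)%:E).

Definition square_integrable p (W : T -> 'cV[R]_p) : Prop :=
  forall i, (fun w => W w i 0) \in Lfun P 2%:E.

Definition covmx p (W : T -> 'cV[R]_p) : 'M[R]_p :=
  \matrix_(i, j) fine (covariance P (fun w => W w i 0) (fun w => W w j 0)).

(* S stands for the inverse square root of the covariance matrix of X. *)
Definition standardize p (S : 'M[R]_p) (X : T -> 'cV[R]_p) (w : T) :
  'cV[R]_p := S *m (X w - mx_expectation X).

End moments.

Section density.
Context d (T : measurableType d) (R : realType) (P : probability T R).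

Definition is_density p (X : {RV P >-> 'cV[R]_p}) (f : 'cV[R]_p -> R) : Prop :=
  [/\ measurable_fun setT f, (forall x, 0 <= f x) &
      forall B, measurable B ->
        distribution P X B = (\int[lebesgue_cV R p]_(x in B) (f x)%:E)%E].

Definition boundary (U : topologicalType) (A : set U) : set U :=
  closure A `\` A°.

(* The topological support: the closure of the set where f does not vanish *)
Definition tsupport p (f : 'cV[R]_p -> R) : set 'cV[R]_p :=
  closure [set x | f x != 0].

Definition has_density_null_boundary p (X : {RV P >-> 'cV[R]_p}) : Prop :=
  exists2 f, is_density X f & lebesgue_cV R p (boundary (tsupport f)) = 0%E.

End density.

Section conditioning.
Context d (T : measurableType d) (R : realType) (P : probability T R).

(* g is a version of the conditional expectation E[f | G], G being a
   sub-sigma-algebra of T; two versions are equal almost surely. *)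
Definition is_cond_exp (G : set (set T)) (f g : T -> R) : Prop :=
  [/\ P.-integrable setT (EFin \o f),
      measurable_fun (setT : set (g_sigma_algebraType G)) g,
      P.-integrable setT (EFin \o g) &
      forall A, G A ->
        (\int[P]_(w in A) (g w)%:E = \int[P]_(w in A) (f w)%:E)%E].

Definition is_cond_exp_mx m n (G : set (set T)) (U V : T -> 'M[R]_(m, n)) :=
  forall i j, is_cond_exp G (fun w => U w i j) (fun w => V w i j).

(* V is a version of var(Z | G) = E[(Z - E[Z | G]) (Z - E[Z | G])^T | G]. *)
Definition is_cond_var p (G : set (set T)) (Z : T -> 'cV[R]_p)
    (V : T -> 'M[R]_p) : Prop :=
  exists2 m, is_cond_exp_mx G Z m &
    is_cond_exp_mx G (fun w => (Z w - m w) *m (Z w - m w)^T) V.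

(* P(A /\ B | G) = P(A | G) P(B | G) a.s. for A in sigma(Y), B in sigma(Z),
   stated on versions of the two conditional probabilities on the right. *)
Definition cond_indep d1 (T1 : measurableType d1) d2 (T2 : measurableType d2)
    (Y : T -> T1) (Z : T -> T2) (G : set (set T)) : Prop :=
  forall A B, measurable A -> measurable B -> exists f g : T -> R,
    [/\ is_cond_exp G \1_(Y @^-1` A) f, is_cond_exp G \1_(Z @^-1` B) g &
        is_cond_exp G \1_(Y @^-1` A `&` Z @^-1` B) (f \* g)].

End conditioning.

Section dimension_reduction.
Context d (T : measurableType d) (R : realType) (P : probability T R).
Context (p : nat).
Implicit Types (Y : T -> R) (Z : T -> 'cV[R]_p) (E : {vspace 'cV[R]_p}).

(* sigma(P_E Z), P_E being the orthogonal projection on E *)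
Definition sigma_proj Z E : set (set T) :=
  g_sigma_algebra_preimage (fun w => orthoproj E *m Z w).

Definition is_DRS Y Z E : Prop := cond_indep P Y Z (sigma_proj Z E).

Definition is_central_subspace Y Z E : Prop :=
  [/\ is_DRS Y Z E,
      (forall F, is_DRS Y Z F -> F != E -> (\dim E < \dim F)%N) &
      forall v, v \in E <-> forall F, is_DRS Y Z F -> v \in F].

Definition orthoprojC E : 'M[R]_p := 1%:M - orthoproj E.

Definition linearity_condition Z E : Prop :=
  exists2 m, is_cond_exp_mx P (sigma_proj Z E) Z m &
    {ae P, forall w, orthoprojC E *m m w = 0}.

Definition diagonal_cond_variance Z E : Prop :=
  exists (V : T -> 'M[R]_p) (lam : {RV P >-> R}),
    is_cond_var P (sigma_proj Z E) Z V /\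
    {ae P, forall w, V w = lam w *: orthoprojC E}.

Definition Mpsi Y Z (psi : R -> R) : 'M[R]_p :=
  mx_expectation P (fun w => psi (Y w) *: (Z w *m (Z w)^T)).

Definition lambda_psi Y Z E (psi : R -> R) : R :=
  (p - \dim E)%:R^-1 *
  fine 'E_P[fun w => sqnorm (orthoprojC E *m Z w) * psi (Y w)].

End dimension_reduction.

(* Main.v *)
(** Write [G] for the sigma-algebra of [P_c Z] and [Q] for [Q_c]. Everything
    rests on one orthogonality principle: an integrable [u] whose integral over
    every set of a sigma-algebra [F] vanishes satisfies [E(u h) = 0] for every
    [F]-measurable [h] such that [u h] is integrable. Using it with [F] equal to
    [G], sigma([Z]) and sigma([Y]) in turn, conditional independence yields
    [E(k(Z) h psi(Y)) = 0] as soon as [E(k(Z) | G) = 0] and [h] is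
    [G]-measurable. Linearity allows [k(Z) = (QZ)_i] and [h = (P_c Z)_j], so
    [Q M P_c = 0]; together with the variance condition it also allows
    [k(Z) = (QZ)_i (QZ)_j - Q_ij |QZ|^2 / (p - d)] and [h = 1], so
    [Q M Q = lambda Q]. Hence [Q (M - lambda I) = 0]. *)

Require Import Defs.
From mathcomp Require Import all_boot all_order all_algebra.
From mathcomp Require Import all_classical all_reals all_analysis.
From mathcomp Require Import finmap measurable_realfun ring.

Set Implicit Arguments.
Unset Strict Implicit.
Unset Printing Implicit Defensive.

Import Order.TTheory GRing.Theory Num.Theory.
Import numFieldNormedType.Exports.
Import HBNNSimple.
Local Open Scope classical_set_scope.
Local Open Scope ring_scope.

(** * Real integrals: restriction to a set, finite linear combinations *)

Section real_integral.
Context d (T : measurableType d) (R : realType) (mu : {measure set T -> \bar R}).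

Lemma Rintegral_indic (A : set T) (f : T -> R) :
  \int[mu]_(x in A) f x = \int[mu]_x (f x * \1_A x).
Proof. by rewrite Rintegral_mkcond patch_indic. Qed.

Lemma integrable_mul_indic (A : set T) (f : T -> R) : measurable A ->
  mu.-integrable setT (EFin \o f) ->
  mu.-integrable setT (EFin \o (f \* \1_A)).
Proof.
move=> mA intf; have mf := measurable_int _ intf.
apply: (le_integrable _ _ _ intf) => //.
  apply/measurable_EFinP; apply: measurable_funM => //.
  exact/measurable_EFinP.
move=> x _ /=; rewrite lee_fin normrM ler_piMr// indicE.
by case: (_ \in _); rewrite ?normr1 ?normr0.
Qed.

(** Indexing by a sequence over any type lets this and the next lemma serve simple functions, matrix
    products, traces and [dev_form] alike. *)
Lemma integrable_lincomb (I : Type) (s : seq I) (c : I -> R) (f : I -> T -> R) :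
  (forall i, mu.-integrable setT (EFin \o f i)) ->
  mu.-integrable setT (EFin \o fun x => \sum_(i <- s) c i * f i x).
Proof.
move=> intf; rewrite (_ : _ \o _ = fun x =>
    (\sum_(i <- s) (c i)%:E * (f i x)%:E)%E); last first.
  by apply/funext => x /=; rewrite sumEFin.
by apply: integrable_sum => // i _; apply: integrableZl => //; exact: intf.
Qed.

Lemma Rintegral_lincomb (I : Type) (s : seq I) (c : I -> R) (f : I -> T -> R)
    (A : set T) : measurable A ->
  (forall i, mu.-integrable setT (EFin \o f i)) ->
  \int[mu]_(x in A) (\sum_(i <- s) c i * f i x) =
  \sum_(i <- s) c i * \int[mu]_(x in A) f i x.
Proof.
move=> mA intf.
have intA g : mu.-integrable setT (EFin \o g) -> mu.-integrable A (EFin \o g).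
  by apply: integrableS.
elim: s => [|i s IH].
  rewrite big_nil (@eq_Rintegral _ _ _ mu A (cst 0)) ?Rintegral_cst ?mul0r//.
  by move=> x _; rewrite big_nil.
rewrite big_cons -IH -RintegralZl//; last exact: intA.
rewrite -RintegralD//.
- by apply: eq_Rintegral => x _; rewrite big_cons.
- exact: intA (integrableZl measurableT (c i) (intf i)).
- exact/intA/integrable_lincomb.
Qed.

End real_integral.

(** * Orthogonality to a sub-sigma-algebra and almost sure nonnegativity *)

Section orthogonality.
Context d (T : measurableType d) (R : realType) (mu : {measure set T -> \bar R}).
Context (F : set (set T)).
Hypotheses (sF : sigma_algebra setT F) (mF : F `<=` measurable).

Lemma measurable_fun_sub d' (T' : measurableType d') (h : T -> T') :
  measurable_fun (setT : set (g_sigma_algebraType F)) h ->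
  measurable_fun (setT : set T) h.
Proof.
move=> mh _ B mB; apply: mF.
by rewrite -(measurable_g_measurableTypeE sF); exact: mh.
Qed.

(** Simple [F]-measurable functions increasing to [h] reduce the claim to sets of [F]; dominated
    convergence with bound [|u h|] passes to the limit, so [h] may be unbounded. *)
Let orth_ge0 (u h : T -> R) :
  mu.-integrable setT (EFin \o u) ->
  (forall A, F A -> \int[mu]_(x in A) u x = 0) ->
  measurable_fun (setT : set (g_sigma_algebraType F)) h ->
  (forall x, 0 <= h x) ->
  mu.-integrable setT (EFin \o (u \* h)) ->
  \int[mu]_x (u x * h x) = 0.
Proof.
move=> intu u0 mh h0 intuh.
have mh' : measurable_fun (setT : set (g_sigma_algebraType F)) (EFin \o h).
  exact/measurable_EFinP.
(* The approximations are built on [T] equipped with [F], so their level sets lie in [F]; [s] is the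
   same sequence read on [T]. *)
pose s' n := nnsfun_approx (@measurableT _ (g_sigma_algebraType F)) mh' n.
pose s n : T -> R := (s' n : g_sigma_algebraType F -> R).
have s0 n : \int[mu]_x (u x * s n x) = 0.
  have mFs y : F (s n @^-1` [set y]).
    rewrite -(measurable_g_measurableTypeE sF).
    exact: (@measurable_funPTI _ _ (g_sigma_algebraType F) _ (s' n)).
  (* Decompose [s n] over its finite range; each term is an integral of [u] over a level set, hence
     0. *)
  rewrite (@eq_Rintegral _ _ _ mu setT (fun x =>
      \sum_(y <- fset_set (range (s n))) y * (u x * \1_(s n @^-1` [set y]) x))).
    rewrite Rintegral_lincomb//; last first.
      by move=> y; apply: integrable_mul_indic => //; exact: mF.
    by rewrite big1// => y _; rewrite -Rintegral_indic u0// mulr0.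
  move=> x _; rewrite {1}/s (fimfunE (s' n)) fsbig_finite//= mulr_sumr.
  by apply: eq_bigr => y _; rewrite mulrCA.
have ms n : measurable_fun (setT : set T) (s n).
  apply: measurable_fun_sub.
  exact: (@measurable_funPT _ _ (g_sigma_algebraType F) _ (s' n)).
have mu' : measurable_fun setT u by exact/measurable_EFinP/(measurable_int _ intu).
have cvs x : EFin \o s ^~ x @ \oo --> (h x)%:E.
  by apply: cvg_nnsfun_approx => // y _; rewrite lee_fin.
have ls n x : s n x <= h x.
  rewrite -lee_fin /s /s' nnsfun_approxE.
  by apply: le_approx => // y _; rewrite lee_fin.
have [] := @dominated_convergence _ _ _ mu setT measurableT
  (fun n x => (u x * s n x)%:E) (EFin \o (u \* h)) (fun x => `|(u x * h x)%:E|%E).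
- by move=> n; apply/measurable_EFinP; apply: measurable_funM.
- exact: measurable_int intuh.
- apply: aeW => x _ /=.
  under eq_fun do rewrite EFinM.
  by rewrite EFinM; apply: cvgeZl => //; exact: cvs.
- exact: integrable_abse.
- apply: aeW => x n _; rewrite lee_fin !normrM ler_wpM2l//.
  by rewrite !ger0_norm//.
move=> _ _ cvI.
(* [Rintegral] sends infinite values to 0, so returning from [s0] to an extended equality requires
   finiteness, which follows from [|u s_n| <= |u h|]. *)
have E n : (\int[mu]_x (u x * s n x)%:E = 0)%E.
  rewrite -[LHS]fineK ?[fine _]s0//; apply: integrable_fin_num => //.
  apply: (le_integrable _ _ _ intuh) => //.
    by apply/measurable_EFinP; apply: measurable_funM.
  move=> x _; rewrite /= lee_fin !normrM ler_wpM2l//.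
  by rewrite !ger0_norm//.
rewrite /Rintegral.
have -> : (\int[mu]_x (u x * h x)%:E = 0)%E; last by [].
rewrite -(cvg_lim (@ereal_hausdorff _) cvI).
apply: cvg_lim => //=; under eq_fun do rewrite E; exact: cvg_cst.
Qed.

(** Both the positive and the negative part of [h] are bounded by [|h|], so their products with [u]
    stay integrable and the nonnegative case applies to each. *)
Lemma Rintegral_mul_eq0 (u h : T -> R) :
  mu.-integrable setT (EFin \o u) ->
  (forall A, F A -> \int[mu]_(x in A) u x = 0) ->
  measurable_fun (setT : set (g_sigma_algebraType F)) h ->
  mu.-integrable setT (EFin \o (u \* h)) ->
  \int[mu]_x (u x * h x) = 0.
Proof.
move=> intu u0 mh intuh.
have mu' : measurable_fun setT u by exact/measurable_EFinP/(measurable_int _ intu).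
have mp : measurable_fun (setT : set (g_sigma_algebraType F)) h^\+.
  exact: measurable_funrpos.
have mn : measurable_fun (setT : set (g_sigma_algebraType F)) h^\-.
  exact: measurable_funrneg.
have hle x : h^\+ x <= `|h x| /\ h^\- x <= `|h x|.
  have -> : `|h x| = h^\+ x + h^\- x by rewrite -[RHS]/((h^\+ + h^\-) x) funrposDneg.
  by split; rewrite ?lerDl ?lerDr ?funrpos_ge0 ?funrneg_ge0.
have ip : mu.-integrable setT (EFin \o (u \* h^\+)).
  apply: (le_integrable _ _ _ intuh) => //.
    apply/measurable_EFinP; apply: measurable_funM => //.
    exact: measurable_fun_sub.
  move=> x _ /=; rewrite lee_fin !normrM ler_wpM2l//.
  by rewrite ger0_norm ?funrpos_ge0//; have [] := hle x.
have im : mu.-integrable setT (EFin \o (u \* h^\-)).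
  apply: (le_integrable _ _ _ intuh) => //.
    apply/measurable_EFinP; apply: measurable_funM => //.
    exact: measurable_fun_sub.
  move=> x _ /=; rewrite lee_fin !normrM ler_wpM2l//.
  by rewrite ger0_norm ?funrneg_ge0//; have [] := hle x.
rewrite (@eq_Rintegral _ _ _ mu setT (fun x => u x * h^\+ x - u x * h^\- x)).
  rewrite RintegralB// !orth_ge0 ?subr0//.
move=> x _; rewrite -mulrBr; congr (_ * _).
by rewrite -{1}(funrposBneg h).
Qed.

(* Test the hypothesis on the set where [f] is negative. *)
Lemma ae_ge0 (f : T -> R) :
  mu.-integrable setT (EFin \o f) ->
  measurable_fun (setT : set (g_sigma_algebraType F)) f ->
  (forall A, F A -> 0 <= \int[mu]_(x in A) f x) ->
  {ae mu, forall x, 0 <= f x}.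
Proof.
move=> intf mf f0.
pose N := f @^-1` `]-oo, 0[%classic.
have FN : F N.
  rewrite -(measurable_g_measurableTypeE sF) -[X in measurable X]setTI.
  by apply: mf => //; exact: measurable_itv.
have mN : measurable N by exact: mF.
have mf' := measurable_fun_sub mf.
have intN : mu.-integrable N (EFin \o f) by apply: integrableS intf.
have : (\int[mu]_(x in N) `|(f x)%:E| = 0)%E.
  rewrite (eq_integral (fun x => (- (f x)%:E))%E); last first.
    move=> x /set_mem; rewrite /N/= in_itv/= => fx.
    by rewrite ltr0_norm.
  rewrite integralN; last exact: integrable_add_def.
  apply/eqP; rewrite oppe_eq0 -[X in X == _]fineK; last exact: integrable_fin_num.
  rewrite eqe eq_le; apply/andP; split; last exact: f0.
  have <- : \int[mu]_(x in N) cst 0 x = 0 by rewrite Rintegral_cst// mul0r.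
  apply: le_Rintegral => //; first exact: integrable0.
  by move=> x; rewrite /N/= in_itv/= => /ltW.
have mfN : measurable_fun N (EFin \o f).
  by apply/measurable_EFinP; exact: measurable_funTS.
move=> /(ae_eq_integral_abs mu mN mfN); apply: filterS => x H.
rewrite leNgt; apply/negP => fx.
have [fx0] : (f x)%:E = 0%E by apply: H; rewrite /N/= in_itv.
by rewrite fx0 ltxx in fx.
Qed.

End orthogonality.

(** * Versions of conditional expectations: bounds, uniqueness, linearity *)

Section conditional_expectation.
Context d (T : measurableType d) (R : realType) (P : probability T R).

(** Meant for [b] a version of a conditional probability, which is bounded by 1 only almost
    surely. *)
Lemma integrable_mul_ae_le1 (f b : T -> R) :
  P.-integrable setT (EFin \o f) -> measurable_fun setT b ->
  {ae P, forall w, `|b w| <= 1} -> P.-integrable setT (EFin \o (f \* b)).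
Proof.
move=> /integrableP[mf intf] mb b1; apply/integrableP.
have mfb : measurable_fun setT (EFin \o (f \* b)).
  by apply/measurable_EFinP; apply: measurable_funM => //; exact/measurable_EFinP.
split=> //; apply: le_lt_trans intf; apply: ae_ge0_le_integral => //.
- exact: measurableT_comp.
- exact: measurableT_comp.
- apply: filterS b1 => w bw _ /=.
  by rewrite lee_fin normrM ler_piMr.
Qed.

Context (G : set (set T)).
Hypotheses (sG : sigma_algebra setT G) (mG : G `<=` measurable).

Lemma cond_exp_Rintegral (f g : T -> R) (A : set T) : is_cond_exp P G f g ->
  G A -> \int[P]_(w in A) g w = \int[P]_(w in A) f w.
Proof. by move=> [_ _ _ H] GA; rewrite /Rintegral H. Qed.

Lemma cond_exp_measurable (f g : T -> R) : is_cond_exp P G f g ->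
  measurable_fun setT g.
Proof. by move=> [_ mg _ _]; exact: (measurable_fun_sub sG mG mg). Qed.

(** Passes between equal integrals and the vanishing form that [Rintegral_mul_eq0] takes and
    returns. *)
Lemma Rintegral_eqB0 (f g : T -> R) (A : set T) : measurable A ->
  P.-integrable setT (EFin \o f) -> P.-integrable setT (EFin \o g) ->
  \int[P]_(w in A) f w = \int[P]_(w in A) g w <->
  \int[P]_(w in A) (f w - g w) = 0.
Proof.
move=> mA intf intg; rewrite RintegralB//; last 2 first.
- exact: integrableS intf.
- exact: integrableS intg.
by split=> [->|/subr0_eq//]; rewrite subrr.
Qed.

(** [ae_ge0] applies to [f] and to [1 - f], since an indicator integrates over each set of [G] to a
    value between 0 and the measure of that set. *)
Lemma cond_exp_indic_le1 (B : set T) (f : T -> R) : measurable B ->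
  is_cond_exp P G \1_B f -> {ae P, forall w, `|f w| <= 1}.
Proof.
move=> mB ce; have [_ mf intf _] := ce.
have int1 : P.-integrable setT (EFin \o cst (1 : R)).
  by apply: finite_measure_integrable_cst.
have f0 : {ae P, forall w, 0 <= f w}.
  apply: (ae_ge0 sG mG) => // A GA; rewrite (cond_exp_Rintegral ce)//.
  by apply: Rintegral_ge0 => w _; rewrite indicE.
have f1 : {ae P, forall w, 0 <= 1 - f w}.
  apply: (ae_ge0 sG mG).
  - exact: (integrableB measurableT int1 intf).
  - by apply: measurable_funB => //; exact: measurable_cst.
  - move=> A GA; have mA := mG GA.
    rewrite RintegralB//; last 2 first.
    + exact: integrableS int1.
    + exact: integrableS intf.
    rewrite (cond_exp_Rintegral ce)// subr_ge0; apply: le_Rintegral => //.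
    + by apply: (integrableS measurableT) => //; exact: integrable_indic.
    + exact: integrableS int1.
apply: filterS2 f0 f1 => w f0 f1.
by rewrite ger0_norm// -subr_ge0.
Qed.

(** The two versions have equal integrals over [G], so [ae_ge0] applies to their difference in both
    orders. *)
Lemma cond_exp_unique (f g1 g2 : T -> R) : is_cond_exp P G f g1 ->
  is_cond_exp P G f g2 -> {ae P, forall w, g1 w = g2 w}.
Proof.
have le g g' : is_cond_exp P G f g -> is_cond_exp P G f g' ->
    {ae P, forall w, 0 <= g w - g' w}.
  move=> ce ce'; have [_ mg intg _] := ce; have [_ mg' intg' _] := ce'.
  apply: (ae_ge0 sG mG).
  - exact: (integrableB measurableT intg intg').
  - exact: measurable_funB.
  - move=> A GA; have mA := mG GA.
    rewrite (Rintegral_eqB0 mA intg intg').1//.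
    by rewrite (cond_exp_Rintegral ce)// (cond_exp_Rintegral ce').
move=> ce1 ce2; apply: filterS2 (le _ _ ce1 ce2) (le _ _ ce2 ce1) => w.
by rewrite !subr_ge0 => ? ?; apply/le_anti/andP.
Qed.

Lemma is_cond_exp_lincomb (I : Type) (s : seq I) (c : I -> R) (f g : I -> T -> R) :
  (forall i, is_cond_exp P G (f i) (g i)) ->
  is_cond_exp P G (fun w => \sum_(i <- s) c i * f i w)
                  (fun w => \sum_(i <- s) c i * g i w).
Proof.
move=> ce.
have intf i : P.-integrable setT (EFin \o f i) by have [] := ce i.
have intg i : P.-integrable setT (EFin \o g i) by have [] := ce i.
split.
- exact: integrable_lincomb.
- apply: measurable_sum => i; apply: measurable_funM => //.
  by have [] := ce i.
- exact: integrable_lincomb.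
- move=> A GA; have mA := mG GA.
  (* [is_cond_exp] equates extended integrals; integrability makes them finite, so linearity of the
     real integral can be used. *)
  have fin h : (forall i, P.-integrable setT (EFin \o h i)) ->
      ((\int[P]_(w in A) (\sum_(i <- s) c i * h i w)%:E) =
      (\sum_(i <- s) c i * \int[P]_(w in A) h i w)%:E)%E.
    move=> inth; rewrite -Rintegral_lincomb// /Rintegral fineK//.
    apply: integrable_fin_num => //.
    by apply: integrableS (integrable_lincomb s c inth).
  rewrite !fin//; congr EFin; apply: eq_bigr => i _.
  by rewrite (cond_exp_Rintegral (ce i)).
Qed.

End conditional_expectation.

(** * Integral consequences of conditional independence *)

Section conditional_independence.
Context d (T : measurableType d) (R : realType) (P : probability T R).

Lemma g_sigma_algebra_preimage_sub d' (T' : measurableType d') (Y : T -> T') :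
  measurable_fun setT Y -> g_sigma_algebra_preimage Y `<=` measurable.
Proof. by move=> mY _ [B mB <-]; exact: mY. Qed.

Lemma sigma_algebra_g_preimage d' (T' : measurableType d') (Y : T -> T') :
  sigma_algebra setT (g_sigma_algebra_preimage Y).
Proof. exact/sigma_algebra_preimage/sigma_algebra_measurable. Qed.

Lemma measurable_fun_g_preimage d' (T' : measurableType d') (Y : T -> T')
    (phi : T' -> R) : measurable_fun setT phi ->
  measurable_fun
    (setT : set (g_sigma_algebraType (g_sigma_algebra_preimage Y))) (phi \o Y).
Proof.
move=> mphi _ B mB; rewrite setTI comp_preimage.
apply: sub_sigma_algebra; exists (phi @^-1` B); last by rewrite setTI.
by rewrite -[X in measurable X]setTI; exact: mphi.
Qed.

Context d1 (T1 : measurableType d1) d2 (T2 : measurableType d2).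
Context (Y : T -> T1) (Z : T -> T2) (G : set (set T)).
Hypotheses (mY : measurable_fun setT Y) (mZ : measurable_fun setT Z).
Hypotheses (sG : sigma_algebra setT G) (mG : G `<=` measurable).
Hypothesis indYZ : cond_indep P Y Z G.

Let mpre d' (T' : measurableType d') (V : T -> T') (B : set T') :
  measurable_fun setT V -> measurable B -> measurable (V @^-1` B).
Proof. by move=> mV mB; rewrite -[X in measurable X]setTI; exact: mV. Qed.

Let indic_sub (A : set T) : G A ->
  measurable_fun (setT : set (g_sigma_algebraType G)) (\1_A : T -> R).
Proof.
move=> GA; apply: (@measurable_indic _ (g_sigma_algebraType G)).
by rewrite (measurable_g_measurableTypeE sG).
Qed.

Let indicM_int (B C : set T) : measurable B -> measurable C ->
  P.-integrable setT (EFin \o (\1_B \* \1_C : T -> R)).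
Proof.
by move=> mB mC; apply: integrable_mul_indic => //; exact: integrable_indic.
Qed.

(* Both sides equal the integral of [f0 * g], where [g] is a version of
   P(Z \in C | G). The version [f] of P(Y \in B | G) provided by [cond_indep]
   depends on [C], which is why it is first exchanged for the fixed [f0]. *)
Let indep_indic (B : set T1) (C : set T2) (A : set T) (f0 : T -> R) :
  measurable B -> measurable C -> G A ->
  is_cond_exp P G \1_(Y @^-1` B) f0 ->
  \int[P]_(w in A) (\1_(Y @^-1` B) w * \1_(Z @^-1` C) w) =
  \int[P]_(w in A) (f0 w * \1_(Z @^-1` C) w).
Proof.
move=> mB mC GA ce0; have mA := mG GA.
have mYB := mpre mY mB; have mZC := mpre mZ mC.
have [f [g [cef ceg cefg]]] := indYZ mB mC.
have [_ mf0 intf0 _] := ce0; have [_ mf intf _] := cef.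
have [intZ mg intg _] := ceg; have [_ _ intfg _] := cefg.
have f01 := cond_exp_indic_le1 sG mG mYB ce0.
have mf0' := cond_exp_measurable sG mG ce0.
have intf0g : P.-integrable setT (EFin \o (f0 \* g)).
  rewrite (_ : f0 \* g = g \* f0); last by apply/funext => w /=; rewrite mulrC.
  exact: integrable_mul_ae_le1.
have intf0Z : P.-integrable setT (EFin \o (f0 \* \1_(Z @^-1` C))).
  exact: integrable_mul_indic.
transitivity (\int[P]_(w in A) (f w * g w)).
  rewrite -[RHS]/(\int[P]_(w in A) (f \* g) w) (cond_exp_Rintegral cefg)//.
  by apply: eq_Rintegral => w _; rewrite indicI.
(* First [f - f0] is tested against the [G]-measurable [g 1_A]; afterwards [g - 1_C(Z)] is tested
   against [f0 1_A]. *)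
transitivity (\int[P]_(w in A) (f0 w * g w)).
  apply/(Rintegral_eqB0 mA intfg intf0g); rewrite Rintegral_indic.
  rewrite (@eq_Rintegral _ _ _ P setT (fun w => (f w - f0 w) * (g w * \1_A w))).
    apply: (Rintegral_mul_eq0 sG mG).
    - exact: (integrableB measurableT intf intf0).
    - move=> D GD; apply/(Rintegral_eqB0 (mG GD) intf intf0).
      by rewrite (cond_exp_Rintegral cef)// (cond_exp_Rintegral ce0).
    - by apply: measurable_funM => //; exact: indic_sub.
    - have := integrable_mul_indic mA (integrableB measurableT intfg intf0g).
      congr (P.-integrable _ _); apply/funext => w /=.
      by congr EFin; ring.
  by move=> w _ /=; ring.
apply/(Rintegral_eqB0 mA intf0g intf0Z); rewrite Rintegral_indic.
rewrite (@eq_Rintegral _ _ _ P setT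
  (fun w => (g w - \1_(Z @^-1` C) w) * (f0 w * \1_A w))).
  apply: (Rintegral_mul_eq0 sG mG).
  - exact: (integrableB measurableT intg intZ).
  - move=> D GD; apply/(Rintegral_eqB0 (mG GD) intg intZ).
    by rewrite (cond_exp_Rintegral ceg).
  - by apply: measurable_funM => //; exact: indic_sub.
  - have := integrable_mul_indic mA (integrableB measurableT intf0g intf0Z).
    congr (P.-integrable _ _); apply/funext => w /=.
    by congr EFin; ring.
by move=> w _ /=; ring.
Qed.

(** Orthogonality over sigma([Z]) replaces the indicator of [Y] in [B] by its conditional
    probability [f0]; as [f0] is [G]-measurable, orthogonality over [G] then annihilates
    [k(Z) f0]. *)
Let indep_fun (B : set T1) (A : set T) (k : T2 -> R) :
  measurable B -> G A -> measurable_fun setT k ->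
  P.-integrable setT (EFin \o (k \o Z)) ->
  (forall D, G D -> \int[P]_(w in D) k (Z w) = 0) ->
  \int[P]_(w in A) (k (Z w) * \1_(Y @^-1` B) w) = 0.
Proof.
move=> mB GA mk intk k0; have mA := mG GA.
have mYB := mpre mY mB.
(* Any measurable set of values of [Z] would do here; the whole space is chosen only to obtain one
   version [f0], fixed before [C] varies. *)
have [f0 [_ [ce0 _ _]]] := indYZ mB (@measurableT _ T2).
have [intY mf0 intf0 _] := ce0.
have f01 := cond_exp_indic_le1 sG mG mYB ce0.
have mf0' := cond_exp_measurable sG mG ce0.
have intkY : P.-integrable setT (EFin \o ((k \o Z) \* \1_(Y @^-1` B))).
  exact: integrable_mul_indic.
have intkf0 : P.-integrable setT (EFin \o ((k \o Z) \* f0)).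
  exact: integrable_mul_ae_le1.
transitivity (\int[P]_(w in A) (k (Z w) * f0 w)); last first.
  rewrite Rintegral_indic.
  rewrite (@eq_Rintegral _ _ _ P setT (fun w => k (Z w) * (f0 w * \1_A w))).
    apply: (Rintegral_mul_eq0 sG mG intk k0).
    - by apply: measurable_funM => //; exact: indic_sub.
    - have := integrable_mul_indic mA intkf0.
      by congr (P.-integrable _ _); apply/funext => w /=; rewrite mulrA.
  by move=> w _; rewrite mulrA.
apply/(Rintegral_eqB0 mA intkY intkf0); rewrite Rintegral_indic.
(* [A] need not lie in sigma([Z]), so its indicator goes into [u] and only [k(Z)] is left as test
   function. *)
pose u w : R := (\1_(Y @^-1` B) w - f0 w) * \1_A w.
have intu : P.-integrable setT (EFin \o u).
  exact: (integrable_mul_indic mA (integrableB measurableT intY intf0)).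
rewrite (@eq_Rintegral _ _ _ P setT (fun w => u w * k (Z w))).
  apply: (Rintegral_mul_eq0 (sigma_algebra_g_preimage Z)
    (g_sigma_algebra_preimage_sub mZ) intu).
  - move=> _ [C mC <-]; rewrite setTI Rintegral_indic.
    have mZC := mpre mZ mC.
    have := indep_indic mB mC GA ce0.
    move/(Rintegral_eqB0 mA (indicM_int mYB mZC)
      (integrable_mul_indic mZC intf0)); rewrite Rintegral_indic => <-.
    by apply: eq_Rintegral => w _; rewrite /u /=; ring.
  - exact: measurable_fun_g_preimage.
  - have := integrable_mul_indic mA (integrableB measurableT intkY intkf0).
    congr (P.-integrable _ _); apply/funext => w /=.
    by rewrite /u /=; congr EFin; ring.
by move=> w _; rewrite /u /=; ring.
Qed.

(** Orthogonality over sigma([Y]) reduces [phi(Y)] to an indicator. That indicator is grouped with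
    [k(Z)], whose product with it integrates to 0 over [G] by [indep_fun], and [h] is then the test
    function over [G]. *)
Lemma cond_indep_Rintegral_eq0 (k : T2 -> R) (h : T -> R) (phi : T1 -> R) :
  measurable_fun setT k -> measurable_fun setT phi ->
  measurable_fun (setT : set (g_sigma_algebraType G)) h ->
  P.-integrable setT (EFin \o (k \o Z)) ->
  (forall A, G A -> \int[P]_(w in A) k (Z w) = 0) ->
  P.-integrable setT (EFin \o ((k \o Z) \* h)) ->
  P.-integrable setT (EFin \o ((k \o Z) \* h \* (phi \o Y))) ->
  \int[P]_w (k (Z w) * h w * phi (Y w)) = 0.
Proof.
move=> mk mphi mh intk k0 intkh intkhphi.
apply: (@Rintegral_mul_eq0 _ _ _ _ _ (sigma_algebra_g_preimage Y)
    (g_sigma_algebra_preimage_sub mY) (fun w => k (Z w) * h w) (phi \o Y)) => //.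
  move=> _ [B mB <-]; rewrite setTI Rintegral_indic.
  have mYB := mpre mY mB.
  rewrite (@eq_Rintegral _ _ _ P setT
      (fun w => k (Z w) * \1_(Y @^-1` B) w * h w)); last first.
    by move=> w _; rewrite mulrAC.
  apply: (@Rintegral_mul_eq0 _ _ _ _ _ sG mG
      (fun w => k (Z w) * \1_(Y @^-1` B) w) h) => //.
  - exact: integrable_mul_indic.
  - by move=> A GA; exact: indep_fun.
  - have := integrable_mul_indic mYB intkh.
    by congr (P.-integrable _ _); apply/funext => w /=; rewrite mulrAC.
exact: measurable_fun_g_preimage.
Qed.

End conditional_independence.

(** * Algebra of orthogonal projections *)

Section orthogonal_projection.
Context (R : realType) (p : nat) (E : {vspace 'cV[R]_p}).

Lemma orthoproj_tr : (orthoproj E)^T = orthoproj E.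
Proof.
by rewrite /orthoproj !trmx_mul trmxK trmx_inv trmx_mul trmxK mulmxA.
Qed.

Lemma orthoproj_idem : orthoproj E *m orthoproj E = orthoproj E.
Proof.
by rewrite /orthoproj -!mulmxA (mulmxA _ (basis_mx E)) mulKVmx ?basis_mx_gram_unit.
Qed.

(** Cyclicity of the trace turns the projection into the identity of size [\dim E]. *)
Lemma mxtrace_orthoproj : \tr (orthoproj E) = (\dim E)%:R.
Proof.
by rewrite /orthoproj -mulmxA mxtrace_mulC -mulmxA mulVmx ?basis_mx_gram_unit// mxtrace1.
Qed.

Lemma orthoprojC_tr : (orthoprojC E)^T = orthoprojC E.
Proof. by rewrite /orthoprojC linearB/= trmx1 orthoproj_tr. Qed.

Lemma orthoprojC_idem : orthoprojC E *m orthoprojC E = orthoprojC E.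
Proof.
by rewrite /orthoprojC mulmxBl !mulmxBr !mul1mx mulmx1 orthoproj_idem subrr subr0.
Qed.

Lemma orthoprojC_outer (v : 'cV[R]_p) :
  orthoprojC E *m (v *m v^T) *m orthoprojC E =
  (orthoprojC E *m v) *m (orthoprojC E *m v)^T.
Proof. by rewrite trmx_mul orthoprojC_tr !mulmxA. Qed.

Lemma mxtrace_orthoprojC : \tr (orthoprojC E) = (p - \dim E)%:R.
Proof.
rewrite /orthoprojC linearB/= mxtrace1 mxtrace_orthoproj natrB//.
by have := dimvS (subvf E); rewrite dimvf /dim/= muln1.
Qed.

(** When [orthoprojC E] kills [M], each column of [M] equals its own projection on [E]. *)
Lemma colspan_sub n (M : 'M[R]_(p, n)) :
  orthoprojC E *m M = 0 -> (colspan M <= E)%VS.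
Proof.
rewrite /orthoprojC mulmxBl mul1mx => /subr0_eq ME.
apply/span_subvP => _ /mapP[j _ ->].
rewrite ME colE -mulmxA; exact: orthoproj_in.
Qed.

(** Used to read the squared norm in [lambda_psi] as a trace. *)
Lemma sqnorm_mxtrace (v : 'cV[R]_p) : sqnorm v = \tr (v *m v^T).
Proof. by rewrite mxtrace_mulC trace_mx11 sqnormE. Qed.

End orthogonal_projection.

(** * Expectations and conditional expectations of random matrices *)

Section matrix_moments.
Context d (T : measurableType d) (R : realType) (P : probability T R).

Lemma mx_expectationE m n (W : T -> 'M[R]_(m, n)) i j :
  mx_expectation P W i j = \int[P]_w W w i j.
Proof. by rewrite mxE unlock. Qed.

Let mull_fun m n q (A : 'M[R]_(q, m)) (W : T -> 'M[R]_(m, n)) i j :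
  (fun w => (A *m W w) i j) = fun w => \sum_k A i k * W w k j.
Proof. by apply/funext => w; rewrite mxE. Qed.

Let mulr_fun m n q (A : 'M[R]_(n, q)) (W : T -> 'M[R]_(m, n)) i j :
  (fun w => (W w *m A) i j) = fun w => \sum_k A k j * W w i k.
Proof.
by apply/funext => w; rewrite mxE; apply: eq_bigr => k _; rewrite mulrC.
Qed.

Lemma mx_integrable_mull m n q (A : 'M[R]_(q, m)) (W : T -> 'M[R]_(m, n)) :
  mx_integrable P W -> mx_integrable P (fun w => A *m W w).
Proof.
move=> iW i j; rewrite -[X in _.-integrable _ X]/(EFin \o fun w => (A *m W w) i j).
by rewrite mull_fun; apply: integrable_lincomb => k; exact: iW.
Qed.

Lemma mx_integrable_mulr m n q (A : 'M[R]_(n, q)) (W : T -> 'M[R]_(m, n)) :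
  mx_integrable P W -> mx_integrable P (fun w => W w *m A).
Proof.
move=> iW i j; rewrite -[X in _.-integrable _ X]/(EFin \o fun w => (W w *m A) i j).
by rewrite mulr_fun; apply: integrable_lincomb => k; exact: iW.
Qed.

Lemma mx_expectation_mull m n q (A : 'M[R]_(q, m)) (W : T -> 'M[R]_(m, n)) :
  mx_integrable P W ->
  mx_expectation P (fun w => A *m W w) = A *m mx_expectation P W.
Proof.
move=> iW; apply/matrixP => i j.
rewrite mx_expectationE mull_fun Rintegral_lincomb//; last by move=> ?; exact: iW.
by rewrite mxE; apply: eq_bigr => k _; rewrite mx_expectationE.
Qed.

Lemma mx_expectation_mulr m n q (A : 'M[R]_(n, q)) (W : T -> 'M[R]_(m, n)) :
  mx_integrable P W ->
  mx_expectation P (fun w => W w *m A) = mx_expectation P W *m A.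
Proof.
move=> iW; apply/matrixP => i j.
rewrite mx_expectationE mulr_fun Rintegral_lincomb//; last by move=> ?; exact: iW.
by rewrite mxE; apply: eq_bigr => k _; rewrite mx_expectationE mulrC.
Qed.

Lemma Rintegral_mxtrace n (W : T -> 'M[R]_n) : mx_integrable P W ->
  \int[P]_w \tr (W w) = \tr (mx_expectation P W).
Proof.
move=> iW; rewrite (@eq_Rintegral _ _ _ P setT (fun w => \sum_k 1 * W w k k)).
  rewrite Rintegral_lincomb//; last by move=> ?; exact: iW.
  by apply: eq_bigr => k _; rewrite mul1r mx_expectationE.
by move=> w _; apply: eq_bigr => k _; rewrite mul1r.
Qed.

Lemma measurable_mulmx_coord m n q (A : 'M[R]_(q, m)) i j :
  measurable_fun setT (fun M : 'M[R]_(m, n) => (A *m M) i j).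
Proof.
rewrite (_ : (fun M => _) = fun M : 'M[R]_(m, n) => \sum_k A i k * M k j).
  by apply: measurable_sum => k; apply: measurable_funM => //; exact: measurable_coord.
by apply/funext => M; rewrite mxE.
Qed.

Lemma ae_eq_Rintegral (f g : T -> R) (A : set T) : measurable A ->
  P.-integrable setT (EFin \o f) -> P.-integrable setT (EFin \o g) ->
  {ae P, forall w, f w = g w} ->
  \int[P]_(w in A) f w = \int[P]_(w in A) g w.
Proof.
move=> mA /measurable_int mf /measurable_int mg fg; rewrite /Rintegral; congr (fine _).
apply: ae_eq_integral => //; [exact: measurable_funTS|exact: measurable_funTS|].
by apply: filterS fg => w fg _; rewrite fg.
Qed.

Context (G : set (set T)).
Hypotheses (sG : sigma_algebra setT G) (mG : G `<=` measurable).

Lemma is_cond_exp_mx_mull m n q (A : 'M[R]_(q, m)) (U V : T -> 'M[R]_(m, n)) :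
  is_cond_exp_mx P G U V ->
  is_cond_exp_mx P G (fun w => A *m U w) (fun w => A *m V w).
Proof.
by move=> UV i j; rewrite !mull_fun; apply: is_cond_exp_lincomb.
Qed.

Lemma is_cond_exp_mx_mulr m n q (A : 'M[R]_(n, q)) (U V : T -> 'M[R]_(m, n)) :
  is_cond_exp_mx P G U V ->
  is_cond_exp_mx P G (fun w => U w *m A) (fun w => V w *m A).
Proof.
by move=> UV i j; rewrite !mulr_fun; apply: is_cond_exp_lincomb.
Qed.

(** There are finitely many entries, so the exceptional null sets can be merged. *)
Lemma cond_exp_mx_unique m n (U V1 V2 : T -> 'M[R]_(m, n)) :
  is_cond_exp_mx P G U V1 -> is_cond_exp_mx P G U V2 ->
  {ae P, forall w, V1 w = V2 w}.
Proof.
move=> ce1 ce2.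
have : {ae P, forall w, forall ij : 'I_m * 'I_n, V1 w ij.1 ij.2 = V2 w ij.1 ij.2}.
  by apply: filter_forall => -[i j]; exact: (cond_exp_unique sG mG (ce1 i j)).
by apply: filterS => w V12; apply/matrixP => i j; exact: (V12 (i, j)).
Qed.

End matrix_moments.

(** * Vanishing conditional means from the linearity and variance conditions *)

Section central_subspace.
Context d (T : measurableType d) (R : realType) (P : probability T R) (p : nat).
Context (Z : T -> 'cV[R]_p) (E : {vspace 'cV[R]_p}).
Hypotheses (mZ : measurable_fun setT Z) (Z_L2 : square_integrable P Z).

Let Q := orthoprojC E.
Let G := sigma_proj Z E.

(** With [A = Q] and [B] the projection on [E], this separates a factor with zero conditional mean
    from a [G]-measurable one. *)
Lemma mx_mul_colE (A B : 'M[R]_p) (v : 'cV[R]_p) i j :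
  (A *m (v *m v^T) *m B^T) i j = (A *m v) i 0 * (B *m v) j 0.
Proof.
rewrite mulmxA -mulmxA -trmx_mul mxE big_ord1.
by rewrite [X in _ * X]mxE.
Qed.

Lemma square_integrable_outer : mx_integrable P (fun w => Z w *m (Z w)^T).
Proof.
move=> i j; have := Lfun2_mul_Lfun1 (Z_L2 i) (Z_L2 j).
move/Lfun1_integrable; congr (_.-integrable _ _).
by apply/funext => w /=; rewrite mxE big_ord1 [X in _ = (_ * X)%:E]mxE.
Qed.

Lemma sigma_algebra_sigma_proj : sigma_algebra setT G.
Proof. exact: sigma_algebra_g_preimage. Qed.

Lemma sigma_proj_sub : G `<=` measurable.
Proof.
apply: g_sigma_algebra_preimage_sub; apply/measurable_fun_mxP => i j.
exact: (measurableT_comp (measurable_mulmx_coord _ i j) mZ).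
Qed.

Let sG := sigma_algebra_sigma_proj.
Let mG := sigma_proj_sub.

(** [Q] passes through the conditional expectation, so [Q m], almost surely 0, is a version of
    [E(QZ | G)]. *)
Lemma linearity_Rintegral_eq0 (i : 'I_p) (A : set T) :
  linearity_condition P Z E -> G A -> \int[P]_(w in A) (Q *m Z w) i 0 = 0.
Proof.
move=> [m ce Qm0] GA; have ceQ := is_cond_exp_mx_mull mG Q ce.
have [_ _ intQm _] := ceQ i 0.
rewrite -(cond_exp_Rintegral (ceQ i 0) GA).
rewrite (@ae_eq_Rintegral _ _ _ _ _ (cst 0))//.
- by rewrite Rintegral_cst ?mul0r//; exact: mG.
- exact: mG.
- exact: integrable0.
- by apply: filterS Qm0 => w ->; rewrite mxE.
Qed.

(* tr Q = p - d, so this linear form vanishes on the multiples of [Q]. *)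
Definition dev_form (i j : 'I_p) (M : 'M[R]_p) : R :=
  M i j - Q i j * (p - \dim E)%:R^-1 * \tr M.

(** Coefficients and entry positions of [dev_form], listed so that the lemmas on linear combinations
    apply to it. *)
Let dev_terms (i j : 'I_p) : seq (R * ('I_p * 'I_p)) :=
  (1, (i, j)) ::
  [seq (- (Q i j * (p - \dim E)%:R^-1), (k, k)) | k <- index_enum 'I_p].

Lemma dev_formE i j (M : 'M[R]_p) :
  dev_form i j M = \sum_(t <- dev_terms i j) t.1 * M t.2.1 t.2.2.
Proof.
by rewrite big_cons big_map/= -mulr_sumr mul1r mulNr.
Qed.

Lemma dev_form_proj i j (c : R) : (\dim E < p)%N -> dev_form i j (c *: Q) = 0.
Proof.
move=> dp; rewrite /dev_form /Q mxE mxtraceZ mxtrace_orthoprojC.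
have : (p - \dim E)%:R != 0 :> R by rewrite pnatr_eq0 -lt0n subn_gt0.
by move=> ?; rewrite mulrCA -mulrA mulVf// mulr1 mulrC subrr.
Qed.

Lemma integrable_dev_form i j (W : T -> 'M[R]_p) : mx_integrable P W ->
  P.-integrable setT (EFin \o fun w => dev_form i j (W w)).
Proof.
move=> iW; rewrite (_ : (fun w => dev_form i j (W w)) =
    fun w => \sum_(t <- dev_terms i j) t.1 * W w t.2.1 t.2.2).
  by apply: integrable_lincomb => t; exact: iW.
by apply/funext => w; exact: dev_formE.
Qed.

Lemma measurable_dev_form i j :
  measurable_fun setT (fun z : 'cV[R]_p => dev_form i j (Q *m (z *m z^T) *m Q)).
Proof.
rewrite (_ : (fun z => _) = fun z : 'cV[R]_p =>
    \sum_(t <- dev_terms i j) t.1 * ((Q *m z) t.2.1 0 * (Q *m z) t.2.2 0)).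
  apply: measurable_sum => t; apply: measurable_funM => //.
  by apply: measurable_funM; exact: measurable_mulmx_coord.
apply/funext => z; rewrite dev_formE; apply: eq_bigr => t _.
by rewrite -mx_mul_colE orthoprojC_tr.
Qed.

Lemma Rintegral_dev_form i j (W : T -> 'M[R]_p) : mx_integrable P W ->
  \int[P]_w dev_form i j (W w) = dev_form i j (mx_expectation P W).
Proof.
move=> iW; under eq_Rintegral do rewrite dev_formE.
rewrite Rintegral_lincomb//; last by move=> t; exact: iW.
by rewrite dev_formE; apply: eq_bigr => t _; rewrite mx_expectationE.
Qed.

Lemma is_cond_exp_dev_form i j (U V : T -> 'M[R]_p) : is_cond_exp_mx P G U V ->
  is_cond_exp P G (fun w => dev_form i j (U w)) (fun w => dev_form i j (V w)).
Proof.
have dE W : (fun w => dev_form i j (W w)) =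
    fun w => \sum_(t <- dev_terms i j) t.1 * W w t.2.1 t.2.2.
  by apply/funext => w; exact: dev_formE.
by move=> UV; rewrite !dE; apply: is_cond_exp_lincomb => // t.
Qed.

(** Since [Q E(Z | G) = 0], centering does not change [Q Z Z^T Q]. Its conditional expectation is
    therefore [Q V Q], almost surely a multiple of [Q], on which [dev_form] vanishes. *)
Lemma dcv_Rintegral_eq0 (i j : 'I_p) (A : set T) : (\dim E < p)%N ->
  linearity_condition P Z E -> diagonal_cond_variance P Z E -> G A ->
  \int[P]_(w in A) dev_form i j (Q *m (Z w *m (Z w)^T) *m Q) = 0.
Proof.
move=> dp [m ce Qm0] [V [lam [[m' ce' ceV] VE]]] GA; have mA := mG GA.
(* The two conditions each bring their own version of [E(Z | G)]; uniqueness carries the linearity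
   condition over to [m']. *)
have Qm'0 : {ae P, forall w, Q *m m' w = 0}.
  by apply: filterS2 Qm0 (cond_exp_mx_unique sG mG ce ce') => w H <-.
have := is_cond_exp_dev_form i j
  (is_cond_exp_mx_mulr mG Q (is_cond_exp_mx_mull mG Q ceV)).
move=> ceD; have [intU _ intV _] := ceD.
transitivity (\int[P]_(w in A)
    dev_form i j (Q *m ((Z w - m' w) *m (Z w - m' w)^T) *m Q)).
  apply: ae_eq_Rintegral => //.
    exact/integrable_dev_form/mx_integrable_mulr/mx_integrable_mull/square_integrable_outer.
  apply: filterS Qm'0 => w Qm'0; congr dev_form.
  by rewrite !orthoprojC_outer mulmxBr Qm'0 subr0.
rewrite -(cond_exp_Rintegral ceD GA).
rewrite (@ae_eq_Rintegral _ _ _ _ _ (cst 0))//.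
- by rewrite Rintegral_cst ?mul0r.
- exact: integrable0.
- apply: filterS VE => w ->.
  rewrite -scalemxAr -scalemxAl orthoprojC_idem orthoprojC_idem.
  exact: dev_form_proj.
Qed.

End central_subspace.

(** * Inclusion of the column space in the central subspace *)

Theorem theorem3p4 (R : realType) (d : measure_display) (T : measurableType d)
    (P : probability T R) (p : nat)
    (Y : {RV P >-> R}) (X : {RV P >-> 'cV[R]_p})
    (S : 'M[R]_p) (Z : T -> 'cV[R]_p) (Ec : {vspace 'cV[R]_p})
    (X_L2 : square_integrable P X)
    (Sigma_unit : covmx P X \in unitmx)
    (S_def : is_invsqrtmx (covmx P X) S)
    (Z_def : Z = standardize P S X)
    (X_density : has_density_null_boundary X)
    (Ec_central : is_central_subspace P Y Z Ec)
    (Ec_dim : (\dim Ec < p)%N)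
    (Z_L2 : square_integrable P Z)
    (Z_linear : linearity_condition P Z Ec)
    (Z_dcv : diagonal_cond_variance P Z Ec)
    (psi : R -> R) (psi_meas : measurable_fun setT psi)
    (psi_int : mx_integrable P (fun w => psi (Y w) *: (Z w *m (Z w)^T))) :
  (colspan (Mpsi P Y Z psi - (lambda_psi P Y Z Ec psi)%:M) <= Ec)%VS.
Proof.
(* [is_cond_exp] includes integrability of the conditioned variable, so the linearity condition
   supplies it for [Z]. *)
have intZ : mx_integrable P Z by case: Z_linear => m ce _ i j; have [] := ce i j.
have mZ : measurable_fun setT Z.
  apply/measurable_fun_mxP => i j.
  exact/measurable_EFinP/(measurable_int _ (intZ i j)).
have mY : measurable_fun setT Y by exact: measurable_funPT.
have indYZ : cond_indep P Y Z (sigma_proj Z Ec) by case: Ec_central.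
have core := cond_indep_Rintegral_eq0 mY mZ
  (sigma_algebra_sigma_proj Z Ec) (sigma_proj_sub mZ) indYZ.
pose Q := orthoprojC Ec; pose Pr := orthoproj Ec.
have PrT : Pr^T = Pr by exact: orthoproj_tr.
pose W w := psi (Y w) *: (Z w *m (Z w)^T).
have intZZ := square_integrable_outer Z_L2.
have int_sandwich (A B : 'M[R]_p) (V : T -> 'M[R]_p) :
    mx_integrable P V -> mx_integrable P (fun w => A *m V w *m B).
  by move=> iV; apply/mx_integrable_mulr/mx_integrable_mull.
have EW (A B : 'M[R]_p) : A *m Mpsi P Y Z psi *m B =
    mx_expectation P (fun w => A *m W w *m B).
  rewrite mx_expectation_mulr ?mx_expectation_mull//.
  exact: mx_integrable_mull.
have QMP : Q *m Mpsi P Y Z psi *m Pr = 0.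
  apply/matrixP => i j; rewrite EW mx_expectationE mxE.
  have QWP w : (Q *m W w *m Pr) i j =
      (Q *m Z w) i 0 * (Pr *m Z w) j 0 * psi (Y w).
    rewrite -scalemxAr -scalemxAl mxE -{1}PrT mx_mul_colE.
    by rewrite mulrC.
  under eq_Rintegral do rewrite QWP.
  apply: (core (fun z => (Q *m z) i 0) (fun w => (Pr *m Z w) j 0) psi) => //.
  - exact: measurable_mulmx_coord.
  - exact: (measurable_fun_g_preimage (Y := fun w => Pr *m Z w)
      (@measurable_coord _ R p 1 j 0)).
  - exact: (mx_integrable_mull Q intZ).
  - by move=> A GA; apply: linearity_Rintegral_eq0.
  - have := int_sandwich Q Pr _ intZZ i j; congr (_.-integrable _ _).
    by apply/funext => w /=; rewrite -{1}PrT mx_mul_colE.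
  - have := int_sandwich Q Pr _ psi_int i j; congr (_.-integrable _ _).
    by apply/funext => w /=; rewrite -QWP.
have QMQ : Q *m Mpsi P Y Z psi *m Q = lambda_psi P Y Z Ec psi *: Q.
  (* The squared norm of [Q Z] is the trace of [Q Z Z^T Q], so [lambda_psi] is the trace of [Q M Q]
     divided by [p - d]. *)
  have lamE : lambda_psi P Y Z Ec psi =
      (p - \dim Ec)%:R^-1 * \tr (Q *m Mpsi P Y Z psi *m Q).
    rewrite /lambda_psi unlock; congr (_ * _); rewrite EW.
    rewrite -Rintegral_mxtrace; last exact: int_sandwich.
    apply: eq_Rintegral => w _.
    rewrite -scalemxAr -scalemxAl mxtraceZ mulrC; congr (_ * _).
    by rewrite orthoprojC_outer sqnorm_mxtrace.
  apply/matrixP => i j; rewrite [RHS]mxE; apply/eqP; rewrite -subr_eq0; apply/eqP.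
  (* With this value of lambda, entry [(i, j)] of [Q M Q - lambda Q] is exactly [dev_form] of
     [Q M Q]. *)
  rewrite lamE [_ * Q i j]mulrC mulrA -/(dev_form Ec i j _) EW.
  rewrite -Rintegral_dev_form; last exact: int_sandwich.
  (* The factor 1 stands for the [G]-measurable [h] of [core]. *)
  have devW w : dev_form Ec i j (Q *m W w *m Q) =
      dev_form Ec i j (Q *m (Z w *m (Z w)^T) *m Q) * 1 * psi (Y w).
    rewrite -scalemxAr -scalemxAl /dev_form mxE mxtraceZ mulr1 mulrBl.
    by rewrite mulrC; congr (_ - _); rewrite mulrCA mulrC.
  under eq_Rintegral do rewrite devW.
  have intD := integrable_dev_form Ec i j (int_sandwich Q Q _ intZZ).
  apply: (core (fun z => dev_form Ec i j (Q *m (z *m z^T) *m Q)) (cst 1) psi) => //.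
  - exact: measurable_dev_form.
  - by move=> A GA; exact: dcv_Rintegral_eq0.
  - move: intD; congr (_.-integrable _ _).
    by apply/funext => w /=; rewrite mulr1.
  - have := integrable_dev_form Ec i j (int_sandwich Q Q _ psi_int).
    congr (_.-integrable _ _).
    by apply/funext => w /=; rewrite -devW.
apply: colspan_sub; rewrite -/Q mulmxBr mul_mx_scalar -QMQ.
(* Writing the identity as [Q + Pr] gives [Q M = Q M Q + Q M Pr], whose last term is 0. *)
rewrite -[X in X - _]mulmx1 -(subrK Pr 1%:M) -/(orthoprojC Ec) -/Q mulmxDr QMP.
by rewrite addr0 subrr.
Qed.
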